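(* Let $(A,q)$ be a finite metric abelian group. (1) For every $Q\in\mathcal Q^-(q)$, the operator $R^{\mathrm I,-}_Q=|A|^{-1/2}\sum_{a\in A}Q(a)\,X_a\otimes Z_a$ on $V\otimes V$ is a unitary Yang--Baxter operator. (2) Let $E\in\mathrm{Aut}(A)$ satisfy $\langle Ex,y\rangle=\langle x,Ey\rangle$ for all $x,y\in A$, and let $Q_E,P_E:A\to\mathrm U(1)$ satisfy $$Q_E(x+y)=Q_E(x)Q_E(y)\langle Ex,y\rangle,\qquad P_E(x+y)=P_E(x)P_E(y)\langle E^{-1}x,y\rangle\qquad(x,y\in A).$$ Then $$R^{\mathrm{II},E}_{Q_E,P_E}=\overline{\gamma(P_E)}\,|A|^{-1}\sum_{t,c\in A}Q_E(t)P_E(c)\,(X_tZ_c)\otimes(X_{-t}Z_c)$$ on $V\otimes V$ is a unitary Yang--Baxter operator.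
   Context: $\mathrm U(1)$ denotes the complex numbers of modulus one. A finite metric abelian group $(A,q)$ is a finite abelian group $A$ (written additively) with a function $q:A\to\mathrm U(1)$ such that $q(-a)=q(a)$ and $\langle a,b\rangle:=\frac{q(a+b)}{q(a)q(b)}$ is a nondegenerate symmetric bicharacter on $A$. Put $\mathcal Q^-(q)=\{q^{-1}\chi:\chi\in\mathrm{Hom}(A,\mathrm U(1))\}$, and for $F:A\to\mathrm U(1)$ put $\gamma(F)=|A|^{-1/2}\sum_{a\in A}F(a)$. $V=\mathbb C[A]$ is the Hilbert space with orthonormal basis $\{e_x:x\in A\}$. For $a\in A$, $X_ae_x=e_{x+a}$ and $Z_ae_x=\langle a,x\rangle e_x$. A unitary Yang--Baxter operator on a finite-dimensional Hilbert space $D$ is a unitary $R\in\mathrm{End}(D\otimes D)$ with $(R\otimes I)(I\otimes R)(R\otimes I)=(I\otimes R)(R\otimes I)(I\otimes R)$. *)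

(* Defs.v *)
From mathcomp Require Import all_boot all_order all_algebra all_fingroup.
From mathcomp Require Import spectral.
From mathcomp Require Import reals.
From mathcomp Require Import complex mxtens.

Set Implicit Arguments.
Unset Strict Implicit.
Unset Printing Implicit Defensive.

Import Order.TTheory GRing.Theory Num.Theory.
Local Open Scope ring_scope.

Definition U1 (R : realType) : {pred R[i]} := [pred z | `|z| == 1].

Section MetricGroups.
Variables (R : realType) (A : finZmodType).
Implicit Types (q F chi Q : A -> R[i]).

Definition is_character chi : Prop :=
  (forall a, chi a \in @U1 R) /\ (forall a b, chi (a + b) = chi a * chi b).

(* The bicharacter written <a, b> in the literature. *)
Definition pairing q (a b : A) : R[i] := q (a + b) / (q a * q b).

(* No symmetry clause: [pairing q] is symmetric because [A] is commutative. *)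
Record is_metric q : Prop := IsMetric {
  metric_U1 : forall a, q a \in @U1 R;
  metric_even : forall a, q (- a) = q a;
  metric_bichar_l : forall b, is_character (fun a => pairing q a b);
  metric_bichar_r : forall a, is_character (pairing q a);
  metric_nondegenerate : forall a, (forall b, pairing q a b = 1) -> a = 0
}.

Definition Qminus q Q : Prop :=
  exists2 chi, is_character chi & forall a, Q a = (q a)^-1 * chi a.

Definition quadratic_along q (T : A -> A) F : Prop :=
  (forall x, F x \in @U1 R) /\
  (forall x y, F (x + y) = F x * F y * pairing q (T x) y).

Definition gauss F : R[i] := (sqrtC #|A|%:R)^-1 * \sum_a F a.

(* Operators on V = C[A] are matrices acting on column vectors, in the
   orthonormal basis indexed by [enum_rank : A -> 'I_#|A|]. *)
Definition basis (x : A) : 'cV[R[i]]_#|A| := delta_mx (enum_rank x) 0.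

Definition Xop (a : A) : 'M[R[i]]_#|A| :=
  \matrix_(i, j) (enum_val i == enum_val j + a)%:R.

Definition Zop q (a : A) : 'M[R[i]]_#|A| :=
  \matrix_(i, j) (pairing q a (enum_val j) *+ (i == j)).

Lemma Xop_basis a x : Xop a *m basis x = basis (x + a).
Proof.
rewrite -colE; apply/colP => i.
by rewrite !mxE enum_rankK eqxx andbT (can2_eq enum_valK enum_rankK).
Qed.

Lemma Zop_basis q a x : Zop q a *m basis x = pairing q a x *: basis x.
Proof.
rewrite -colE; apply/colP => i.
by rewrite !mxE enum_rankK eqxx andbT mulr_natr.
Qed.

Definition R_I q Q : 'M[R[i]]_(#|A| * #|A|) :=
  (sqrtC #|A|%:R)^-1 *: \sum_(a : A) Q a *: (Xop a *t Zop q a).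

Definition R_II q (QE PE : A -> R[i]) : 'M[R[i]]_(#|A| * #|A|) :=
  ((gauss PE)^* / #|A|%:R) *:
    \sum_(t : A) \sum_(c : A)
      (QE t * PE c) *: ((Xop t *m Zop q c) *t (Xop (- t) *m Zop q c)).

End MetricGroups.

Arguments basis R {A} x.
Arguments Xop R {A} a.

(* D is C^n with its standard inner product, and S is an operator on
   D (x) D = C^(n * n).  S (x) I lives on C^((n * n) * n) and I (x) S on
   C^(n * (n * n)); since [mxtens_index] is row-major, the associator is the
   identity on indices, that is [castmx] along [mulnA]. *)
Definition tens_id_r (R : realType) n (S : 'M[R[i]]_(n * n)) :
  'M[R[i]]_(n * n * n) := S *t 1%:M.

Definition tens_id_l (R : realType) n (S : 'M[R[i]]_(n * n)) :
  'M[R[i]]_(n * n * n) :=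
  castmx (mulnA n n n, mulnA n n n) (1%:M *t S).

Lemma mxtens_indexA n (i j k : 'I_n) :
  cast_ord (mulnA n n n) (mxtens_index (i, mxtens_index (j, k))) =
  mxtens_index (mxtens_index (i, j), k).
Proof. by apply: val_inj; rewrite /= mulnDl mulnA addnA. Qed.

Definition unitary_YB (R : realType) n (S : 'M[R[i]]_(n * n)) : Prop :=
  S \is unitarymx /\
  tens_id_r S *m tens_id_l S *m tens_id_r S =
  tens_id_l S *m tens_id_r S *m tens_id_l S.

(* Main.v *)
(** Both operators have the form z * sum_g F(g) U(g), where U is a unitary
    representation of a finite abelian group G and F is a U(1)-valued function
    on G whose polar form B(g, h) = F(g + h) / (F(g) F(h)) is a nondegenerate
    bicharacter: G = A, F = Q for type I and G = A x A, F(t, c) = Q_E(t) P_E(c)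
    for type II.  Unitarity is orthogonality of characters.  The two copies U, W
    of the representation on the tensor cube satisfy
    U(g) W(h) = B(L g, h)^-1 W(h) U(g) for some bijection L of G preserving B,
    namely L = id, respectively L (t, c) = (- E^-1 c, - E t).  In both sides of
    the braid relation, the coefficient of W(h) U(k) is a sum over G, and
    the substitution g |-> L g identifies the two sums term by term. *)
From HB Require Import structures.
Require Import Defs.
From mathcomp Require Import all_boot all_order all_algebra all_fingroup.
From mathcomp Require Import spectral.
From mathcomp Require Import reals complex mxtens ring.
Import Order.TTheory GRing.Theory Num.Theory.
Set Implicit Arguments.
Unset Strict Implicit.
Unset Printing Implicit Defensive.
Local Open Scope ring_scope.
Local Open Scope sesquilinear_scope.

(** * Complex numbers of modulus one and additive maps *)

Section UnitCircle.
Variable R : realType.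
Implicit Types z w : R[i].

Lemma U1_neq0 z : z \in @U1 R -> z != 0.
Proof. by rewrite inE -normr_gt0 => /eqP->; rewrite ltr01. Qed.

Lemma U1_conj z : z \in @U1 R -> z^* = z^-1.
Proof. by rewrite inE invC_norm => /eqP->; rewrite expr1n invr1 mul1r. Qed.

Lemma U1M z w : z \in @U1 R -> w \in @U1 R -> z * w \in @U1 R.
Proof. by rewrite !inE normrM => /eqP-> /eqP->; rewrite mulr1. Qed.

Lemma U1V z : z \in @U1 R -> z^-1 \in @U1 R.
Proof. by rewrite !inE normfV => /eqP->; rewrite invr1. Qed.

End UnitCircle.

Lemma morphD0 (G H : zmodType) (f : G -> H) :
  {morph f : x y / x + y} -> f 0 = 0.
Proof. by move=> fD; apply: (addrI (f 0)); rewrite -fD !addr0. Qed.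

Lemma morphDN (G H : zmodType) (f : G -> H) :
  {morph f : x y / x + y} -> {morph f : x / - x}.
Proof.
by move=> fD x; apply: (addIr (f x)); rewrite -fD !addNr (morphD0 fD).
Qed.

Lemma pairingC (R : realType) (G : finZmodType) (F : G -> R[i]) a b :
  pairing F a b = pairing F b a.
Proof. by rewrite /pairing addrC [F a * _]mulrC. Qed.

(* Weaker than [is_metric]: the functions Q, Q_E and P_E need not be even. *)
Record nondeg_quadratic (R : realType) (G : finZmodType) (F : G -> R[i]) :
    Prop := NondegQuadratic {
  quad_U1 : forall a, F a \in @U1 R;
  quad_pairingDl : forall a b c,
    pairing F (a + b) c = pairing F a c * pairing F b c;
  quad_nondeg : forall a, (forall b, pairing F a b = 1) -> a = 0
}.

(** * Nondegenerate quadratic functions, character orthogonality and Gauss sums *)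

Section Quadratic.
Variables (R : realType) (G : finZmodType) (F : G -> R[i]).
Hypothesis quadF : nondeg_quadratic F.
Implicit Types a b c g h : G.
Local Notation B := (pairing F).

Lemma quad_neq0 a : F a != 0.
Proof. exact/U1_neq0/(quad_U1 quadF). Qed.

Lemma pairing_U1 a b : B a b \in @U1 R.
Proof. by rewrite U1M ?U1V ?U1M ?(quad_U1 quadF). Qed.

Lemma pairing_neq0 a b : B a b != 0.
Proof. exact/U1_neq0/pairing_U1. Qed.

Lemma quadD a b : F (a + b) = F a * F b * B a b.
Proof. by rewrite /pairing mulrC divfK // mulf_neq0 ?quad_neq0. Qed.

Lemma pairingDr a b c : B a (b + c) = B a b * B a c.
Proof. by rewrite pairingC (quad_pairingDl quadF) !(pairingC _ a). Qed.

Lemma pairing0l b : B 0 b = 1.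
Proof.
apply: (mulfI (pairing_neq0 0 b)).
by rewrite -(quad_pairingDl quadF) addr0 mulr1.
Qed.

Lemma pairingNl a b : B (- a) b = (B a b)^-1.
Proof.
apply: (mulfI (pairing_neq0 a b)).
by rewrite -(quad_pairingDl quadF) subrr pairing0l divff ?pairing_neq0.
Qed.

Lemma pairingNr a b : B a (- b) = (B a b)^-1.
Proof. by rewrite pairingC pairingNl pairingC. Qed.

Lemma quad0 : F 0 = 1.
Proof.
have := quadD 0 0; rewrite pairing0l addr0 mulr1 -{1}[F 0]mulr1.
by move/(mulfI (quad_neq0 0)).
Qed.

(** If [B a b != 1] for some [b], translating the summation variable by [b] multiplies the sum by
    [B a b], so the sum vanishes. *)
Lemma sum_pairing a : \sum_h B a h = (#|G| * (a == 0))%:R.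
Proof.
case: (eqVneq a 0) => [->|a_neq0].
  by rewrite muln1 (eq_bigr _ (fun h _ => pairing0l h)) sumr_const.
rewrite muln0; have [b bN1] : exists b, B a b != 1.
  apply/existsP; apply: contra_neqT a_neq0; rewrite negb_exists => /forallP eq1.
  by apply: (quad_nondeg quadF) => b; have := eq1 b; rewrite negbK => /eqP.
have: (B a b - 1) * \sum_h B a h = 0.
  apply/eqP; rewrite mulrBl mul1r subr_eq0 [X in _ == X](reindex_inj (addrI b)).
  by rewrite mulr_sumr; apply/eqP/eq_bigr => h _; rewrite pairingDr.
by move/eqP; rewrite mulf_eq0 subr_eq0 (negPf bN1) => /eqP.
Qed.

(** Collected by the difference [d = g - h], the coefficient of [T d] is [F d] times the sum of
    [B d h] over [h], so only [d = 0] survives. Values in a module let it serve both for matrices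
    (unitarity) and for scalars (Gauss sums). *)
Lemma quad_autocorrelation (V : lmodType R[i]) (T : G -> V) :
  \sum_g \sum_h (F g * (F h)^*) *: T (g - h) = #|G|%:R *: T 0.
Proof.
rewrite exchange_big /=.
under eq_bigr => h _ do rewrite (reindex_inj (addIr h)) /=.
rewrite exchange_big /= (bigD1 (0 : G)) //= [X in _ + X]big1 ?addr0 => [|g g_neq0].
  under eq_bigr => h _ do
    rewrite addrK add0r U1_conj ?(quad_U1 quadF) // divff ?quad_neq0 //.
  by rewrite -scaler_suml sumr_const.
under eq_bigr => h _ do
  rewrite addrK quadD U1_conj ?(quad_U1 quadF) // (mulrAC (F g)) mulfK
    ?quad_neq0 //.
by rewrite -scaler_suml -mulr_sumr sum_pairing (negPf g_neq0) muln0 mulr0 scale0r.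
Qed.

(** Isolates the dependence on [a] in values of [B], which are all that a map preserving [B]
    controls. *)
Lemma quad_split a b : F a * F (b - a) = F b * B a a / B a b.
Proof.
have := quadD a (b - a); rewrite subrKC pairingDr pairingNr => ->.
by field; rewrite !pairing_neq0.
Qed.

Lemma card_neq0 : #|G|%:R != 0 :> R[i].
Proof. by rewrite pnatr_eq0 -lt0n; apply/card_gt0P; exists 0. Qed.

Lemma sqrtC_card_inv_sqr :
  (sqrtC #|G|%:R)^-1 * ((sqrtC #|G|%:R)^-1)^* * #|G|%:R = 1 :> R[i].
Proof.
rewrite geC0_conj ?invr_ge0 ?sqrtC_ge0 ?ler0n //.
by rewrite -invfM -expr2 sqrtCK mulVf ?card_neq0.
Qed.

(** This is the autocorrelation identity for the constant [T = 1], with the scalars seen as a module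
    over themselves. *)
Lemma gauss_mul_conj : gauss F * (gauss F)^* = 1.
Proof.
have := quad_autocorrelation (fun=> 1 : (R[i])^o); rewrite /GRing.scale /= mulr1.
move=> autoF; rewrite /gauss rmorphM mulrACA rmorph_sum mulr_suml.
under eq_bigr => g _ do rewrite mulr_sumr.
rewrite -[RHS]sqrtC_card_inv_sqr -autoF; congr (_ * _).
by apply: eq_bigr => g _; apply: eq_bigr => h _; rewrite mulr1.
Qed.

End Quadratic.

(** * Unitarity and braid relation for quadratic sums over a representation *)

Section QuadraticSum.
Variables (R : realType) (G : finZmodType) (F : G -> R[i]) (n : nat).
Hypothesis quadF : nondeg_quadratic F.
Implicit Types (g h k : G) (U W : G -> 'M[R[i]]_n).
Local Notation B := (pairing F).

Lemma mulmx_sum3 (u v w : G -> R[i]) (U V W : G -> 'M[R[i]]_n) :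
  (\sum_g u g *: U g) *m (\sum_h v h *: V h) *m (\sum_k w k *: W k) =
  \sum_g \sum_h \sum_k (u g * v h * w k) *: (U g *m V h *m W k).
Proof.
rewrite 2!mulmx_suml; apply: eq_bigr => g _.
rewrite -mulmxA mulmx_suml mulmx_sumr; apply: eq_bigr => h _.
rewrite 2!mulmx_sumr; apply: eq_bigr => k _.
by rewrite mulmxA -!(scalemxAl, scalemxAr) !scalerA; congr (_ *: _); ring.
Qed.

(** The product of the sum with its adjoint is the autocorrelation of [F] with [T = U]. *)
Lemma quad_sum_unitary U (z : R[i]) :
    U 0 = 1%:M -> {morph U : g h / g + h >-> g *m h} ->
    (forall g, (U g)^t* = U (- g)) -> z * z^* * #|G|%:R = 1 ->
  z *: \sum_g F g *: U g \is unitarymx.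
Proof.
move=> U0 UD UN zG; apply/unitarymxP.
have -> : (z *: \sum_g F g *: U g)^t* = z^* *: \sum_g (F g)^* *: U (- g).
  rewrite linearZ /= map_mxZ linear_sum /= raddf_sum; congr (_ *: _).
  by apply: eq_bigr => g _; rewrite linearZ /= map_mxZ UN.
rewrite -scalemxAl -scalemxAr scalerA mulmx_suml.
under eq_bigr => g _.
  rewrite mulmx_sumr.
  under eq_bigr => h _ do rewrite -scalemxAl -scalemxAr scalerA -UD.
  over.
by rewrite (quad_autocorrelation quadF U) scalerA zG scale1r U0.
Qed.

Lemma quad_sum_braid U W (L : G -> G) :
    {morph U : g h / g + h >-> g *m h} -> {morph W : g h / g + h >-> g *m h} ->
    injective L -> (forall g h, B (L g) (L h) = B g h) ->
    (forall g h, U g *m W h = (B (L g) h)^-1 *: (W h *m U g)) ->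
  let SU := \sum_g F g *: U g in let SW := \sum_g F g *: W g in
  SU *m SW *m SU = SW *m SU *m SW.
Proof.
move=> UD WD injL BL UW SU SW; rewrite !mulmx_sum3.
(* Here [k] becomes the total of the two [U] indices: [U g *m W h *m U (k - g)] is a multiple of
   [W h *m U k]. *)
transitivity (\sum_g \sum_h \sum_k
    (F h * (F g * F (k - g)) / B (L g) h) *: (W h *m U k)).
  apply: eq_bigr => g _; apply: eq_bigr => h _.
  rewrite (reindex_inj (addIr (- g))); apply: eq_bigr => k _ /=.
  rewrite UW -scalemxAl -mulmxA -UD addrCA subrr addr0 scalerA.
  by congr (_ *: _); ring.
(* On the other side [l] is the index of the last [W] factor and [h] the total of the two:
   [W (h - l) *m U k *m W l] is again a multiple of [W h *m U k]. *)
transitivity (\sum_l \sum_h \sum_k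
    (F k * (F l * F (h - l)) / B (L k) l) *: (W h *m U k)); last first.
  apply: esym; rewrite exchange_big /=.
  under eq_bigr => k _ do rewrite exchange_big /=.
  rewrite exchange_big; apply: eq_bigr => l _ /=.
  rewrite exchange_big (reindex_inj (addIr (- l))) /=.
  apply: eq_bigr => h _; apply: eq_bigr => k _.
  rewrite -mulmxA UW -scalemxAr mulmxA -WD subrK scalerA.
  by congr (_ *: _); ring.
(* With [l = L g], [quad_split] leaves [F h * F k * B g g / (B g k * B (L g) h)] on both sides. *)
rewrite [RHS](reindex_inj injL); apply: eq_bigr => g _.
apply: eq_bigr => h _; apply: eq_bigr => k _.
by rewrite !quad_split // !BL [B k g]pairingC; congr (_ *: _); ring.
Qed.

End QuadraticSum.

(** * The two embeddings of the tensor square into the tensor cube *)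

Section TensorLegs.
Variables (R : realType) (n : nat).
Implicit Types (S T : 'M[R[i]]_(n * n)) (M N : 'M[R[i]]_n).

Lemma tensmx11 (m p : nat) : 1%:M *t 1%:M = 1%:M :> 'M[R[i]]_(m * p).
Proof.
apply/matrixP=> i j.
case: (mxtens_indexP i) => i1 i2; case: (mxtens_indexP j) => j1 j2.
rewrite tensmxE !mxE -natrM mulnb (can_eq (@mxtens_indexK _ _)).
by rewrite xpair_eqE.
Qed.

Fact tens_id_r_is_linear : linear (@tens_id_r R n).
Proof.
move=> z S T; apply/matrixP=> i j.
by rewrite /tens_id_r !mxE mulrDl mulrA.
Qed.
HB.instance Definition _ := GRing.isLinear.Build _ _ _ _ _ tens_id_r_is_linear.

Fact tens_id_l_is_linear : linear (@tens_id_l R n).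
Proof.
move=> z S T; apply/matrixP=> i j.
by rewrite /tens_id_l !(castmxE, mxE) mulrDr mulrCA.
Qed.
HB.instance Definition _ := GRing.isLinear.Build _ _ _ _ _ tens_id_l_is_linear.

Lemma tens_id_rM : {morph @tens_id_r R n : S T / S *m T}.
Proof. by move=> S T; rewrite /tens_id_r tensmx_mul mulmx1. Qed.

Lemma tens_id_lM : {morph @tens_id_l R n : S T / S *m T}.
Proof.
move=> S T; rewrite /tens_id_l -{1}[1%:M]mulmx1 -tensmx_mul.
by case: _ / (mulnA n n n).
Qed.

(** Removes the cast, so that both embeddings can be multiplied factor by factor. *)
Lemma tens_id_l_tens M N : tens_id_l (M *t N) = 1%:M *t M *t N.
Proof.
apply/matrixP=> i j.
case: (mxtens_indexP i) => i12 i3; case: (mxtens_indexP i12) => i1 i2.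
case: (mxtens_indexP j) => j12 j3; case: (mxtens_indexP j12) => j1 j2.
rewrite -!mxtens_indexA /tens_id_l castmxE !cast_ordK !mxtens_indexA.
by rewrite !tensmxE mulrA.
Qed.

(** The two embeddings overlap only in the middle factor, where [N] meets [M']. *)
Lemma tens_id_comm (M N M' N' : 'M[R[i]]_n) (z : R[i]) :
    N *m M' = z *: (M' *m N) ->
  tens_id_r (M *t N) *m tens_id_l (M' *t N') =
  z *: (tens_id_l (M' *t N') *m tens_id_r (M *t N)).
Proof.
move=> NM'; rewrite tens_id_l_tens /tens_id_r !tensmx_mul NM'.
rewrite !(mulmx1, mul1mx); apply/matrixP=> i j; rewrite !mxE; ring.
Qed.

Lemma quad_sum_YB (G : finZmodType) (F : G -> R[i]) (L : G -> G)
    (U : G -> 'M[R[i]]_(n * n)) (z : R[i]) :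
    nondeg_quadratic F ->
    injective L -> (forall g h, pairing F (L g) (L h) = pairing F g h) ->
    U 0 = 1%:M -> {morph U : g h / g + h >-> g *m h} ->
    (forall g, (U g)^t* = U (- g)) ->
    (forall g h, tens_id_r (U g) *m tens_id_l (U h) =
       (pairing F (L g) h)^-1 *: (tens_id_l (U h) *m tens_id_r (U g))) ->
    z * z^* * #|G|%:R = 1 ->
  unitary_YB (z *: \sum_g F g *: U g).
Proof.
move=> quadF injL BL U0 UD UN UU zG; split; first exact: quad_sum_unitary.
(* Both sides of the braid relation are cubic in [z], so the scalars can be stripped. *)
rewrite !linearZ /= -!(scalemxAl, scalemxAr); congr (_ *: (_ *: (_ *: _))).
have sumE (f : {linear 'M[R[i]]_(n * n) -> 'M[R[i]]_(n * n * n)}) :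
    f (\sum_g F g *: U g) = \sum_g F g *: f (U g).
  by rewrite linear_sum; apply: eq_bigr => g _; rewrite linearZ.
rewrite !sumE /=; apply: (quad_sum_braid quadF (L := L)) => //.
- by move=> g h; rewrite /= UD tens_id_rM.
- by move=> g h; rewrite /= UD tens_id_lM.
Qed.

End TensorLegs.

(** Makes the product a [finZmodType], as type II sums over [A * A]. *)
HB.instance Definition _ (G H : finZmodType) := GRing.Zmodule.on (G * H)%type.

(** * Weyl operators and their commutation phases *)

Section Weyl.
Variables (R : realType) (A : finZmodType) (q : A -> R[i]).
Hypothesis quadq : nondeg_quadratic q.
Implicit Types (a b c t : A) (g h : A * A).

Lemma basis_ext (M N : 'M[R[i]]_#|A|) :
  (forall x : A, M *m basis R x = N *m basis R x) -> M = N.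
Proof.
move=> eqMN; apply/matrixP=> i j; have := eqMN (enum_val j).
by rewrite /basis enum_valK -!colE => /colP/(_ i); rewrite !mxE.
Qed.

(** These form a projective representation of the phase space [A * A], with cocycle
    [pairing q g.2 h.1]. *)
Definition weyl g : 'M[R[i]]_#|A| := Xop R g.1 *m Zop q g.2.

Lemma weyl_basis g x :
  weyl g *m basis R x = pairing q g.2 x *: basis R (x + g.1).
Proof. by rewrite -mulmxA Zop_basis -scalemxAr Xop_basis. Qed.

Lemma weyl_X a : Xop R a = weyl (a, 0).
Proof.
by apply: basis_ext => x; rewrite Xop_basis weyl_basis pairing0l ?scale1r.
Qed.

Lemma weyl_Z a : Zop q a = weyl (0, a).
Proof. by apply: basis_ext => x; rewrite Zop_basis weyl_basis addr0. Qed.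

Lemma weyl0 : weyl 0 = 1%:M.
Proof.
by apply: basis_ext => x; rewrite weyl_basis pairing0l // scale1r addr0 mul1mx.
Qed.

Lemma weylM g h : weyl g *m weyl h = pairing q g.2 h.1 *: weyl (g + h).
Proof.
apply: basis_ext => x; rewrite -mulmxA -scalemxAl !weyl_basis -scalemxAr.
rewrite weyl_basis !scalerA (quad_pairingDl quadq) (pairingDr quadq).
by rewrite -addrA (addrC h.1); congr (_ *: _); ring.
Qed.

Lemma weyl_adjoint g : (weyl g)^t* = pairing q g.2 g.1 *: weyl (- g).
Proof.
case: g => t c.
have adjX a : (Xop R a)^t* = Xop R (- a).
  apply/matrixP=> i j; rewrite !mxE rmorph_nat.
  by rewrite -[in RHS](inj_eq (addIr a)) subrK eq_sym.
have adjZ a : (Zop q a)^t* = Zop q (- a).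
  apply/matrixP=> i j; rewrite !mxE eq_sym.
  case: eqP => [->|_]; last exact: rmorph0.
  by rewrite U1_conj ?pairing_U1 // pairingNl.
(* The adjoint reverses the order; moving [Zop q (- c)] back past [Xop R (- t)] costs the phase,
   where the two signs cancel. *)
rewrite trmx_mul map_mxM adjX adjZ weyl_X weyl_Z weylM /= pairingNl // pairingNr //.
by rewrite invrK; congr (_ *: weyl (_, _)); rewrite ?addr0 ?add0r.
Qed.

(** The first condition on [u] and [v] makes the cocycles of the two tensor factors cancel, giving a
    true representation of [G]. The second matches the commutation phase in the middle factor,
    between [weyl (v g)] and [weyl (u h)], with [L]. *)
Lemma weyl_YB (G : finZmodType) (F : G -> R[i]) (L : G -> G)
    (u v : G -> A * A) (z : R[i]) :
    {morph u : g h / g + h} -> {morph v : g h / g + h} ->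
    nondeg_quadratic F ->
    injective L -> (forall g h : G, pairing F (L g) (L h) = pairing F g h) ->
    (forall g h : G,
       pairing q (u g).2 (u h).1 * pairing q (v g).2 (v h).1 = 1) ->
    (forall g h : G, pairing q (v g).2 (u h).1 / pairing q (u h).2 (v g).1 =
       (pairing F (L g) h)^-1) ->
    z * z^* * #|G|%:R = 1 ->
  unitary_YB (z *: \sum_g F g *: (weyl (u g) *t weyl (v g))).
Proof.
move=> uD vD quadF injL BL uv1 uvB zG; apply: (quad_sum_YB (L := L)) => //.
- by rewrite (morphD0 uD) (morphD0 vD) weyl0 tensmx11.
- move=> g h; rewrite tensmx_mul !weylM // uD vD.
  by apply/matrixP=> i j; rewrite !mxE mulrACA uv1 mul1r.
- move=> g; rewrite trmx_tens map_mxT !weyl_adjoint // (morphDN uD) (morphDN vD).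
  by apply/matrixP=> i j; rewrite !mxE mulrACA uv1 mul1r.
- move=> g h; apply: tens_id_comm; rewrite -uvB !weylM scalerA.
  by rewrite divfK ?pairing_neq0 // addrC.
Qed.

End Weyl.

(** * Quadratic functions from metrics, twists and products *)

Section QuadraticConstructions.
Variable R : realType.

Lemma metric_nondeg_quadratic (A : finZmodType) (q : A -> R[i]) :
  is_metric q -> nondeg_quadratic q.
Proof.
by case=> qU1 _ qbi _ qnd; split=> // a b c; case: (qbi c) => _ ->.
Qed.

Lemma quadratic_along_pairing (A : finZmodType) (q F : A -> R[i]) (T : A -> A) :
  quadratic_along q T F -> forall a b, pairing F a b = pairing q (T a) b.
Proof.
case=> FU1 FD a b; rewrite {1}/pairing FD mulrAC divff ?mul1r //.
by rewrite mulf_neq0 ?U1_neq0.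
Qed.

Lemma quadratic_along_nondeg (A : finZmodType) (q F : A -> R[i]) (T : A -> A) :
    nondeg_quadratic q -> injective T -> {morph T : x y / x + y} ->
  quadratic_along q T F -> nondeg_quadratic F.
Proof.
move=> quadq injT TD alongF; have pairF := quadratic_along_pairing alongF.
split=> [a|a b c|a eq1]; first by case: alongF.
  by rewrite !pairF TD (quad_pairingDl quadq).
apply: injT; rewrite (morphD0 TD).
by apply: (quad_nondeg quadq) => b; rewrite -pairF.
Qed.

Section Product.
Variables (G H : finZmodType) (F1 : G -> R[i]) (F2 : H -> R[i]).
Let F12 (g : G * H) := F1 g.1 * F2 g.2.

Lemma pairing_prod g h :
  pairing F12 g h = pairing F1 g.1 h.1 * pairing F2 g.2 h.2.
Proof. by rewrite /pairing /F12 [X in _ / X]mulrACA invfM mulrACA. Qed.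

(** The polar form is the product of the two polar forms; pairing with [(c, 0)] and [(0, c)]
    separates the components. *)
Lemma nondeg_quadratic_prod :
  nondeg_quadratic F1 -> nondeg_quadratic F2 -> nondeg_quadratic F12.
Proof.
move=> quad1 quad2; split=> [g|g h k|[a b] eq1].
- by rewrite U1M ?(quad_U1 quad1) ?(quad_U1 quad2).
- by rewrite !pairing_prod (quad_pairingDl quad1) (quad_pairingDl quad2) mulrACA.
congr pair.
  apply: (quad_nondeg quad1) => c; have := eq1 (c, 0).
  by rewrite pairing_prod [pairing F2 _ _]pairingC (pairing0l quad2) mulr1.
apply: (quad_nondeg quad2) => c; have := eq1 (0, c).
by rewrite pairing_prod [pairing F1 _ _]pairingC (pairing0l quad1) mul1r.
Qed.

End Product.

End QuadraticConstructions.

(** * The two families of Yang-Baxter operators *)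

Lemma R_I_unitary_YB (R : realType) (A : finZmodType) (q Q : A -> R[i]) :
  nondeg_quadratic q -> Qminus q Q -> unitary_YB (R_I q Q).
Proof.
move=> quadq [chi [chiU1 chiD] Qdef].
(* The character cancels from the polar form, leaving that of the inverse of [q]. *)
have pairQ a b : pairing Q a b = (pairing q a b)^-1.
  rewrite /pairing !Qdef chiD.
  by field; rewrite !(quad_neq0 quadq) !U1_neq0.
have quadQ : nondeg_quadratic Q.
  split=> [a|a b c|a eq1].
  - by rewrite Qdef U1M ?U1V ?(quad_U1 quadq).
  - by rewrite !pairQ (quad_pairingDl quadq) invfM.
  - by apply: (quad_nondeg quadq) => b; rewrite -[LHS]invrK -pairQ eq1 invr1.
rewrite /R_I; under eq_bigr => a _ do rewrite (weyl_X quadq) weyl_Z.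
apply: (weyl_YB quadq (L := id) (u := fun a => (a, 0)) (v := pair 0)) => //=.
- by move=> a b; congr pair; rewrite /= addr0.
- by move=> a b; congr pair; rewrite /= addr0.
- by move=> a b; rewrite pairing0l // pairingC pairing0l // mulr1.
- by move=> a b; rewrite pairQ invrK pairing0l // divr1.
- exact: sqrtC_card_inv_sqr.
Qed.

Lemma R_II_unitary_YB (R : realType) (A : finZmodType) (q QE PE : A -> R[i])
    (E : {perm A}) :
    nondeg_quadratic q -> {morph E : x y / x + y} ->
    (forall x y : A, pairing q (E x) y = pairing q x (E y)) ->
    quadratic_along q E QE -> quadratic_along q (E^-1)%g PE ->
  unitary_YB (R_II q QE PE).
Proof.
move=> quadq ED Esym alongQ alongP.
have EVD : {morph (E^-1)%g : x y / x + y}.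
  by move=> x y; apply: (@perm_inj _ E); rewrite ED !permKV.
have EN x := morphDN ED x.
have pairQ := quadratic_along_pairing alongQ.
have pairP := quadratic_along_pairing alongP.
have quadQ := quadratic_along_nondeg quadq perm_inj ED alongQ.
have quadP := quadratic_along_nondeg quadq perm_inj EVD alongP.
have quadF := nondeg_quadratic_prod quadQ quadP.
rewrite /R_II pair_big.
(* The middle phase is [pairing q g.2 h.1 * pairing q h.2 g.1]; solving for [L] against the form
   twisted by [E] and its inverse gives this map. *)
apply: (weyl_YB quadq (L := fun g => (- (E^-1)%g g.2, - E g.1))
  (u := id) (v := fun g => (- g.1, g.2)) _ _ quadF) => //=.
- by move=> g h; congr pair; rewrite /= opprD.
- by move=> [a b] [c d] /= [/oppr_inj/perm_inj-> /oppr_inj/perm_inj->].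
- move=> g h; rewrite !pairing_prod /= !pairQ !pairP.
  rewrite EN -(EN g.1) permK permKV.
  rewrite !(pairingNl quadq, pairingNr quadq) !invrK.
  (* Writing [h.2] as the image under [E] of its preimage transfers the self-adjointness of [E] to
     its inverse. *)
  by rewrite -[in RHS](permKV E h.2) -!Esym permKV mulrC.
- by move=> g h; rewrite (pairingNr quadq) divff ?(pairing_neq0 quadq).
- move=> g h; rewrite pairing_prod pairQ pairP /=.
  rewrite EN -(EN g.1) permK permKV !(pairingNl quadq, pairingNr quadq).
  by rewrite (pairingC q h.2) [RHS]invfM !invrK.
(* The Gauss sum has modulus one, so the squared modulus of the prefactor is the inverse of the
   order of [A * A]. *)
move: (gauss_mul_conj quadP); move: (gauss PE) => z zz1.
rewrite -normCK normf_div norm_conjC normr_nat expr_div_n normCK zz1.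
by rewrite card_prod natrM mul1r -expr2 mulVf // expf_neq0 // card_neq0.
Qed.

Theorem corollary4p9 (R : realType) (A : finZmodType) (q : A -> R[i])
    (q_metric : is_metric q) :
  (forall Q : A -> R[i], Qminus q Q -> unitary_YB (R_I q Q)) /\
  (forall (E : {perm A}) (QE PE : A -> R[i]),
     {morph E : x y / x + y} ->
     (forall x y : A, pairing q (E x) y = pairing q x (E y)) ->
     quadratic_along q E QE ->
     quadratic_along q (E^-1)%g PE ->
     unitary_YB (R_II q QE PE)).
Proof.
have quadq := metric_nondeg_quadratic q_metric.
split=> [Q|E QE PE]; first exact: R_I_unitary_YB.
exact: R_II_unitary_YB.
Qed.
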